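(* Let $\mathcal S=\{x\in\mathbb R^2:\|x\|\le1.1\}$ and $F(x)=(I+2J)x$ with $J=\begin{pmatrix}0&-1\\1&0\end{pmatrix}$, and put $\lambda=1$ and $\alpha=0.05$. Then $F$ is $1$-strongly monotone and $\sqrt5$-Lipschitz, and $\bar x=0$ is the unique solution of the variational inequality $\mathrm{VI}(F,\mathcal S)$. For $x\ne0$ set $s=\|x\|$, $e_r=x/s$, $e_\theta=Je_r$, $R(\theta)=[e_r,e_\theta]$ (the matrix with columns $e_r,e_\theta$, where $\theta$ is the polar angle of $x$), and put $$B=\begin{pmatrix}1&-1/2\\-1/2&1/2\end{pmatrix}\succ0,\qquad p(u)=10u^3-15u^4+6u^5,\qquad \chi(s)=\begin{cases}p(s/0.8),&s\le0.8,\\1,&s>0.8.\end{cases}$$ Define $$\mathbb M(x)=(1-\chi)I+\chi\,R(\theta)BR(\theta)^\top,\qquad \mathbb M(0)=I,$$ where $\chi=\chi(\|x\|)$. Then $\mathbb M$ is $C^2$, uniformly positive definite and Lipschitz, with $D\mathbb M(0)=0$. With $r_\alpha=1.1/\sqrt{1+\alpha^2/4}$, every circle $\|x\|=s$ with $0.8\le s\le r_\alpha$ is a periodic orbit of the flow $\dot x=\lambda(T(x)-x)$. Moreover $\mathbb M^{-1}$ is not the Hessian of a potential on that annulus $0.8\le\|x\|\le r_\alpha$.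
   Context: $\langle\cdot,\cdot\rangle$ and $\|\cdot\|$ are the Euclidean inner product and norm, $I$ is the identity matrix, and $B\succ0$ means that $B$ is positive definite. $F$ is $\mu$-strongly monotone if $\langle F(x)-F(y),x-y\rangle\ge\mu\|x-y\|^2$ for all $x,y\in\mathcal S$. $\mathrm{VI}(F,\mathcal S)$: find $\bar x\in\mathcal S$ with $\langle F(\bar x),x-\bar x\rangle\ge0$ for all $x\in\mathcal S$. For $Q$ symmetric positive definite, $P_{\mathcal S,Q}(y):=\operatorname{argmin}_{z\in\mathcal S}\tfrac12(z-y)^\top Q(z-y)$, and $T(x):=P_{\mathcal S,\mathbb M(x)^{-1}}\bigl(x-\alpha\mathbb M(x)F(x)\bigr)$ for $x\in\mathcal S$. Uniformly positive definite means that the eigenvalues of $\mathbb M(x)$ are bounded below by a positive constant independent of $x$. *)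

(* Defs.v *)
From HB Require Import structures.
From mathcomp Require Import all_boot all_order all_algebra.
From mathcomp Require Import all_classical all_reals all_analysis.

Set Implicit Arguments.
Unset Strict Implicit.
Unset Printing Implicit Defensive.

Import Order.TTheory GRing.Theory Num.Theory.
Import numFieldNormedType.Exports.

Local Open Scope classical_set_scope.
Local Open Scope ring_scope.

Section Generic.
Variables (R : realType) (n : nat).
Implicit Types (x y v : 'cV[R]_n) (A Q : 'M[R]_n) (S : set 'cV[R]_n).
Implicit Types (F : 'cV[R]_n -> 'cV[R]_n) (M : 'cV[R]_n -> 'M[R]_n).

Definition inner x y : R := \sum_i x i 0 * y i 0.

(* The norm `|x| of the normed module 'cV[R]_n is the maximum norm; it is only
   used through the topology and the derivatives it induces. *)
Definition enorm x : R := Num.sqrt (inner x x).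

Definition symmetric A := A^T = A.

Definition posdef A :=
  symmetric A /\ forall x, x != 0 -> 0 < inner x (A *m x).

(* A symmetric real matrix has only real eigenvalues, so that it is enough to
   bound the eigenvalues in R. *)
Definition uniformly_posdef M :=
  exists2 c : R, 0 < c &
    forall x, symmetric (M x) /\ forall a, eigenvalue (M x) a -> c <= a.

Definition strongly_monotone (mu : R) S F :=
  forall x y, S x -> S y -> mu * enorm (x - y) ^+ 2 <= inner (F x - F y) (x - y).

Definition elipschitz (L : R) F :=
  forall x y, enorm (F x - F y) <= L * enorm (x - y).

(* The operator norm of A induced by the Euclidean norm is at most c. *)
Definition opnorm_le A (c : R) := forall v, enorm (A *m v) <= c * enorm v.

Definition matrix_lipschitz M :=
  exists L : R, forall x y, opnorm_le (M x - M y) (L * enorm (x - y)).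

Definition VI_solution F S x :=
  S x /\ forall y, S y -> 0 <= inner (F x) (y - x).

Definition proj_obj Q y z : R := 1 / 2 * inner (z - y) (Q *m (z - y)).

Definition is_proj S Q y z :=
  S z /\ forall w, S w -> proj_obj Q y z <= proj_obj Q y w.

(* The minimizer is unique when S is nonempty, closed and convex and Q is
   positive definite; y is a dummy value in the absence of a minimizer. *)
Definition proj S Q y : 'cV[R]_n := xget y [set z | is_proj S Q y z].

Definition T_map S F M (alpha : R) x : 'cV[R]_n :=
  proj S (invmx (M x)) (x - alpha *: (M x *m F x)).

(* O is the orbit of a nonconstant periodic solution, staying in S, of the
   autonomous equation x' = f x. *)
Definition periodic_orbit S (f : 'cV[R]_n -> 'cV[R]_n) (O : set 'cV[R]_n) :=
  exists (g : R -> 'cV[R]_n) (tau : R),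
    [/\ forall t, S (g t) /\ is_derive t (1 : R) g (f (g t)),
        0 < tau,
        forall t, g (t + tau) = g t,
        exists t, g t <> g 0
      & range g = O].

Definition unit_vec (i : 'I_n) : 'cV[R]_n := delta_mx i 0.

(* All partial derivatives of order at most 2 exist and are continuous on the
   whole space. *)
Definition C2 (V : normedModType R) (f : 'cV[R]_n -> V) :=
  [/\ continuous f,
      forall i, (forall x, derivable f x (unit_vec i)) /\
                continuous ('D_(unit_vec i) f)
    & forall i j,
        (forall x, derivable ('D_(unit_vec j) f) x (unit_vec i)) /\
        continuous ('D_(unit_vec i) ('D_(unit_vec j) f))].

Definition twice_differentiable_at (phi : 'cV[R]_n -> R) x :=
  (\forall y \near x, differentiable phi y) /\
  forall i, differentiable ('D_(unit_vec i) phi) x.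

Definition hessian (phi : 'cV[R]_n -> R) x : 'M[R]_n :=
  \matrix_(i, j) 'D_(unit_vec i) ('D_(unit_vec j) phi) x.

(* The derivatives are two-sided, hence only considered at interior points of
   A: nothing is required of phi on the boundary of A. *)
Definition is_hessian_on (A : set 'cV[R]_n) (phi : 'cV[R]_n -> R) M :=
  forall x, A° x -> twice_differentiable_at phi x /\ hessian phi x = M x.

End Generic.

Section Example.
Variable R : realType.
Implicit Types (x : 'cV[R]_2) (s u : R).

Definition mx2 (a b c d : R) : 'M[R]_2 :=
  \matrix_(i, j) if i == 0 then (if j == 0 then a else b)
                 else (if j == 0 then c else d).

Definition Sball : set 'cV[R]_2 := [set x | enorm x <= 11 / 10].

Definition J : 'M[R]_2 := mx2 0 (-1) 1 0.

Definition F x : 'cV[R]_2 := (1%:M + 2 *: J) *m x.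

Definition lambda : R := 1.

Definition alpha : R := 5 / 100.

Definition B : 'M[R]_2 := mx2 1 (- (1 / 2)) (- (1 / 2)) (1 / 2).

Definition p u : R := 10 * u ^+ 3 - 15 * u ^+ 4 + 6 * u ^+ 5.

Definition chi s : R := if s <= 8 / 10 then p (s / (8 / 10)) else 1.

Definition e_r x : 'cV[R]_2 := (enorm x)^-1 *: x.

Definition e_theta x : 'cV[R]_2 := J *m e_r x.

(* R(theta), as a function of x != 0 instead of its polar angle theta *)
Definition Rot x : 'M[R]_2 := row_mx (e_r x) (e_theta x).

Definition MM x : 'M[R]_2 :=
  if x == 0 then 1%:M
  else (1 - chi (enorm x)) *: 1%:M
       + chi (enorm x) *: (Rot x *m B *m (Rot x)^T).

Definition T x : 'cV[R]_2 := T_map Sball F MM alpha x.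

Definition field x : 'cV[R]_2 := lambda *: (T x - x).

Definition r_alpha : R := 11 / 10 / Num.sqrt (1 + alpha ^+ 2 / 4).

Definition circle s : set 'cV[R]_2 := [set x | enorm x = s].

Definition annulus : set 'cV[R]_2 := [set x | 8 / 10 <= enorm x <= r_alpha].

End Example.

(* Main.v *)
(** Writing [s] for the Euclidean norm of [x], [MM x] is [1 + phi(s) P(x)] where
    [P] is a quadratic form with matrix values and [phi(s) = chi(s) / s^2] is
    [O(s)] at the origin. Every partial derivative of order at most 2 is a sum
    of terms [phi_k(s) x_0^i x_1^j] with [phi_(k+1) = phi_k' / s]; the order of
    vanishing of such a term at the origin decides whether it is continuous or
    differentiable there, and [phi_k] is [C^(2-k)] across the circle [s = 0.8].

    On the annulus, [MM x *m F x = (1/2) J x], so the unconstrained step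
    [x - (alpha/2) J x] has norm [s * sqrt (1 + alpha^2/4)], stays in the ball
    and is fixed by the projection: the flow is a rotation.

    On the annulus the inverse metric is homogeneous of degree 0 and maps [x] to
    [2 x + 2 J x]. If it were the Jacobian of a gradient [G], integrating along
    the rays through [u = (1, t)] would give
    [G_0 (u) - G_0 (9/10 u) = (1 - t) / 5], whose derivative at [t = 0] is
    [-1/5], while the chain rule gives [2 - 9/5]. *)

Require Import Defs.
From mathcomp Require Import all_boot all_order all_algebra.
From mathcomp Require Import all_classical all_reals all_analysis.
From mathcomp Require Import ring lra zify.
Import Order.TTheory GRing.Theory Num.Theory.
Import numFieldNormedType.Exports.
Local Open Scope classical_set_scope.
Local Open Scope ring_scope.

(** * Directional derivatives *)

(** Both sides have the same difference quotient. This carries the one-variable chain rule and the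
    mean value theorem over to directional derivatives. *)
Lemma is_derive_line {R : realFieldType} {V W : normedModType R}
    (f : V -> W) (x v : V) (t : R) (d : W) :
  is_derive (t *: v + x) v f d <->
  is_derive t 1 (fun h : R => f (h *: v + x)) d.
Proof.
have E : (fun h : R => h^-1 *: ((f \o shift (t *: v + x)) (h *: v) - f (t *: v + x)))
  = (fun h : R => h^-1 *: (((fun h : R => f (h *: v + x)) \o shift t) (h *: 1)
                             - f (t *: v + x))).
  by apply/funext => h /=; rewrite scalerDl addrA [h *: 1]mulr1.
split=> -[dfx <-]; constructor.
- by move: dfx; rewrite /derivable E.
- by rewrite /derive E.
- by move: dfx; rewrite /derivable E.
- by rewrite /derive E.
Qed.

Lemma is_derive_comp_real {R : realType} {V : normedModType R}
    {g : R -> R} {f : V -> R} {x v : V} {a b : R} :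
  is_derive (f x) 1 g a -> is_derive x v f b ->
  is_derive x v (fun y => g (f y)) (a * b).
Proof.
move=> dg df; rewrite -[x]add0r -[X in X + x](scale0r v).
apply/is_derive_line.
apply: (@is_derive1_comp R g (fun h : R => f (h *: v + x)) 0).
  by rewrite scale0r add0r.
by apply/is_derive_line; rewrite scale0r add0r.
Qed.

Lemma is_derive_linear {R : realFieldType} {V W : normedModType R}
    (f : {linear V -> W}) (x v : V) : is_derive x v f (f v).
Proof.
have E : (fun h : R => h^-1 *: ((f \o shift x) (h *: v) - f x)) @ 0^' --> f v.
  apply: cvg_near_cst; near=> h.
  rewrite /= -linearB addrK linearZ scalerA mulVf ?scale1r//.
  by near: h; exact: nbhs_dnbhs_neq.
by constructor; [apply/cvg_ex; exists (f v) | exact/cvg_lim].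
Unshelve. all: by end_near. Qed.

(** The bound makes [f y - f x] a little-o of [y - x]. This handles the origin, where the formulas
    for the radial profiles are singular. *)
Lemma is_diff_quadratic {R : realType} {V W : normedModType R}
    (f : V -> W) (x : V) (C : R) :
  (forall y, `|f y - f x| <= C * `|y - x| ^+ 2) -> is_diff x f 0.
Proof.
move=> fC.
have c0 : continuous (\0 : V -> W) by move=> y; exact: cst_continuous.
have E : f \o shift x = cst (f x) + (\0 : V -> W) +o_ 0 id.
  apply/eqaddoP => e e0; near=> y.
  rewrite /= !fctE addr0; apply: le_trans (fC _) _; rewrite addrK expr2 mulrA.
  rewrite ler_wpM2r//.
  (* Since [C] may be zero or negative, [|C| + 1] replaces it as a positive divisor of [e]. *)
  apply: (@le_trans _ _ ((`|C| + 1) * `|y|)).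
    by rewrite ler_wpM2r// (le_trans (ler_norm _))// lerDl.
  rewrite -ler_pdivlMl ?ltr_wpDl//.
  by near: y; apply: nbhs0_le; rewrite mulr_gt0// invr_gt0 ltr_wpDl.
have D := diff_unique c0 E.
by constructor => //; apply/diff_locallyP; rewrite D.
Unshelve. all: by end_near. Qed.

Lemma is_derive_quadratic {R : realType} {V W : normedModType R}
    (f : V -> W) (x v : V) (C : R) :
  (forall y, `|f y - f x| <= C * `|y - x| ^+ 2) -> is_derive x v f 0.
Proof.
move=> fC; have [df dfE] := is_diff_quadratic f x C fC.
by constructor; [exact: diff_derivable | rewrite deriveE// dfE].
Qed.

(** Away from [c] a single branch is active nearby. At [c] every difference quotient of the glued
    function is a quotient of [g] or of [k], and both tend to [d]. *)
Lemma is_derive_glue {R : realType} (g k : R -> R) (c x d : R) :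
  (x <= c -> is_derive x 1 g d) -> (c <= x -> is_derive x 1 k d) ->
  g c = k c -> is_derive x 1 (fun y => if y <= c then g y else k y) d.
Proof.
move=> dg dk gk; have [xc|cx|xc] := ltgtP x c.
- apply: near_eq_is_derive (dg (ltW xc)).
  by near=> y; rewrite ifT//; near: y; exact: lt_le_nbhsl.
- apply: near_eq_is_derive (dk (ltW cx)).
  by near=> y; rewrite leNgt ifF//; apply/negbF; near: y; exact: lt_nbhsr.
- subst x.
  have [{}dg dgE] := dg (lexx c); have [{}dk dkE] := dk (lexx c).
  set q := fun f : R -> R => fun h : R => h^-1 *: ((f \o shift c) (h *: 1) - f c).
  have qg : q g h @[h --> 0^'] --> d by rewrite -dgE.
  have qk : q k h @[h --> 0^'] --> d by rewrite -dkE.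
  have E : q (fun y => if y <= c then g y else k y) h @[h --> 0^'] --> d.
    apply/cvgrPdist_le => e e0; near=> h; rewrite /q /= lexx.
    case: ifP => _.
    + by near: h; move/cvgrPdist_le : qg; exact.
    + by rewrite gk; near: h; move/cvgrPdist_le : qk; exact.
  by constructor; [apply/cvg_ex; exists d | exact/cvg_lim].
Unshelve. all: by end_near. Qed.

Lemma continuous_glue {R : realType} (g k : R -> R) (c x : R) :
  (x <= c -> {for x, continuous g}) -> (c <= x -> {for x, continuous k}) ->
  g c = k c -> {for x, continuous (fun y => if y <= c then g y else k y)}.
Proof.
move=> dg dk gk; apply/cvgrPdist_le => e e0 /=; have [xc|cx|xc] := ltgtP x c.
- near=> y; rewrite ifT; last by near: y; exact: lt_le_nbhsl.
  by near: y; move/cvgrPdist_le : (dg (ltW xc)); exact.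
- near=> y; rewrite ifF; last first.
    by apply/negbTE; rewrite -ltNge; near: y; exact: lt_nbhsr.
  by near: y; move/cvgrPdist_le : (dk (ltW cx)); exact.
- subst x; near=> y; case: ifP => _.
  + by near: y; move/cvgrPdist_le : (dg (lexx c)); exact.
  + by rewrite gk; near: y; move/cvgrPdist_le : (dk (lexx c)); exact.
Unshelve. all: by end_near. Qed.

Lemma continuous_squeeze {R : realType} {V W : normedModType R}
    (f : V -> W) (g : V -> R) (x : V) :
  (forall y, `|f x - f y| <= g y) -> g x = 0 -> {for x, continuous g} ->
  {for x, continuous f}.
Proof.
move=> fg gx cg; apply/cvgrPdist_le => e e0; near=> y.
apply: le_trans (fg y) _; apply: le_trans (ler_norm _) _.
rewrite -normrN -sub0r -gx; near: y.
by move/cvgrPdist_le : cg; exact.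
Unshelve. all: by end_near. Qed.

Lemma is_derive_scalel {R : realType} {V W : normedModType R}
    {f : V -> R} (c : W) {x v : V} {d : R} :
  is_derive x v f d -> is_derive x v (fun y => f y *: c) (d *: c).
Proof.
move=> [df <-].
have E : (fun h : R => h^-1 *: (((fun y => f y *: c) \o shift x) (h *: v) - f x *: c))
   @ 0^' --> 'D_v f x *: c.
  have df' : h^-1 * (f (h *: v + x) - f x) @[h --> 0^'] --> 'D_v f x by exact: df.
  under eq_fun do rewrite /= -scalerBl scalerA.
  exact: (cvgZr_tmp df').
by constructor; [apply/cvg_ex; exists ('D_v f x *: c) | exact/cvg_lim].
Qed.

(** * The Euclidean plane *)

Section Entries.
Variables (R : pzRingType) (m n : nat).
Implicit Types A : 'M[R]_(m, n).

Lemma addmxE A A' i j : (A + A') i j = A i j + A' i j.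
Proof. by rewrite mxE. Qed.

Lemma oppmxE A i j : (- A) i j = - A i j.
Proof. by rewrite mxE. Qed.

Lemma scalemxE c A i j : (c *: A) i j = c * A i j.
Proof. by rewrite mxE. Qed.

Lemma onemxE i j : (1%:M : 'M[R]_n) i j = (i == j)%:R.
Proof. by rewrite mxE. Qed.

End Entries.

Definition entryE := (addmxE, oppmxE, scalemxE, onemxE).

Section Plane.
Variable R : realType.
Implicit Types (x y v : 'cV[R]_2) (A : 'M[R]_2) (s : R).

Lemma innerE x y : inner x y = x 0 0 * y 0 0 + x 1 0 * y 1 0.
Proof.
rewrite /inner big_ord_recl big_ord1.
by rewrite (_ : lift _ _ = 1)//; exact/val_inj.
Qed.

Lemma ord2P (i : 'I_2) : i = 0 \/ i = 1.
Proof. by case: i => [[|[|//]] ?]; [left|right]; exact/val_inj. Qed.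

Lemma cV2_eq x y : x 0 0 = y 0 0 -> x 1 0 = y 1 0 -> x = y.
Proof.
by move=> h0 h1; apply/matrixP => i j; rewrite (ord1 j); case: (ord2P i) => ->.
Qed.

Lemma M2_eq A A' : A 0 0 = A' 0 0 -> A 0 1 = A' 0 1 -> A 1 0 = A' 1 0 ->
  A 1 1 = A' 1 1 -> A = A'.
Proof.
move=> h00 h01 h10 h11; apply/matrixP => i j.
by case: (ord2P i) => ->; case: (ord2P j) => ->.
Qed.

Lemma mulmx2E m n (A : 'M[R]_(m, 2)) (B : 'M[R]_(2, n)) i j :
  (A *m B) i j = A i 0 * B 0 j + A i 1 * B 1 j.
Proof.
by rewrite mxE big_ord_recl big_ord1 (_ : lift _ _ = 1)//; exact/val_inj.
Qed.

Lemma mx2E00 a b c d : mx2 a b c d 0 0 = a :> R. Proof. by rewrite mxE. Qed.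
Lemma mx2E01 a b c d : mx2 a b c d 0 1 = b :> R. Proof. by rewrite mxE. Qed.
Lemma mx2E10 a b c d : mx2 a b c d 1 0 = c :> R. Proof. by rewrite mxE. Qed.
Lemma mx2E11 a b c d : mx2 a b c d 1 1 = d :> R. Proof. by rewrite mxE. Qed.
Definition mx2E := (mx2E00, mx2E01, mx2E10, mx2E11).

Lemma sqr_enorm x : enorm x ^+ 2 = x 0 0 ^+ 2 + x 1 0 ^+ 2.
Proof. by rewrite sqr_sqrtr innerE -?expr2 ?addr_ge0 ?sqr_ge0. Qed.

Lemma enorm_ge0 x : 0 <= enorm x.
Proof. exact: sqrtr_ge0. Qed.

Lemma enorm_le_sqr x s : 0 <= s -> (enorm x <= s) = (x 0 0 ^+ 2 + x 1 0 ^+ 2 <= s ^+ 2).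
Proof. by move=> s0; rewrite -sqr_enorm ler_sqr ?nnegrE ?enorm_ge0. Qed.

Lemma enorm_eq_sqr x s : 0 <= s -> x 0 0 ^+ 2 + x 1 0 ^+ 2 = s ^+ 2 -> enorm x = s.
Proof.
by move=> s0; rewrite -sqr_enorm => /eqP; rewrite eqrXn2 ?enorm_ge0// => /eqP.
Qed.

Lemma enorm0_eq0 x : enorm x = 0 -> x = 0.
Proof.
move=> x0; have := sqr_enorm x; rewrite x0 expr0n /= => /esym/eqP.
rewrite paddr_eq0 ?sqr_ge0// !sqrf_eq0 => /andP[/eqP h0 /eqP h1].
by apply: cV2_eq; rewrite mxE.
Qed.

Lemma enorm0 : enorm (0 : 'cV[R]_2) = 0.
Proof. by apply: enorm_eq_sqr => //; rewrite !mxE expr0n /= addr0. Qed.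

Lemma enorm_gt0 x : (0 < enorm x) = (x != 0).
Proof.
rewrite lt_def enorm_ge0 andbT; apply/idP/idP; apply: contra => /eqP.
  by move=> ->; rewrite enorm0.
by move=> /enorm0_eq0 ->.
Qed.

Lemma coord_le_enorm x (i : 'I_2) : `|x i 0| <= enorm x.
Proof.
have := sqr_enorm x; rewrite -(ler_sqr (normr_ge0 _) (enorm_ge0 _)) => ->.
rewrite -normrX ger0_norm ?sqr_ge0//.
by case: (ord2P i) => ->; rewrite ?lerDl ?lerDr sqr_ge0.
Qed.

Lemma coord_le_norm x (i : 'I_2) : `|x i 0| <= `|x|.
Proof.
by rewrite [leRHS]/Num.Def.normr/= mx_normrE; exact: (le_bigmax _ _ (i, 0)).
Qed.

(** The crude factor 2 suffices to pass from Euclidean bounds to the maximum norm, in which the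
    quadratic criteria for a zero derivative are applied. *)
Lemma enorm_le_norm x : enorm x <= 2 * `|x|.
Proof.
rewrite enorm_le_sqr ?mulr_ge0//.
have h i : x i 0 ^+ 2 <= `|x| ^+ 2.
  by rewrite -real_normK ?num_real// ler_sqr ?nnegrE// coord_le_norm.
have := h 0; have := h 1; rewrite exprMn; have := sqr_ge0 `|x|; lra.
Qed.

Lemma is_derive_coord x v (i : 'I_2) :
  is_derive x v (fun y : 'cV[R]_2 => y i 0) (v i 0).
Proof.
have @f : {linear 'cV[R]_2 -> R}.
  by exists (fun N : 'cV[R]_2 => N i 0); do 2![eexists]; do ?[constructor];
     rewrite ?mxE// => ? *; rewrite ?mxE//; move=> ?; rewrite !mxE.
exact: (is_derive_linear f).
Qed.

Lemma continuous_enorm : continuous (@enorm R 2).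
Proof.
move=> x; rewrite (_ : @enorm R 2 = fun x => Num.sqrt (x 0 0 * x 0 0 + x 1 0 * x 1 0)).
  apply: (@continuous_comp _ _ _ (fun x : 'cV[R]_2 => x 0 0 * x 0 0 + x 1 0 * x 1 0)).
    by apply: continuousD; apply: continuousM; exact: coord_continuous.
  exact: sqrt_continuous.
by apply/funext => y; rewrite /enorm innerE.
Qed.

Lemma is_derive_enorm x v : x != 0 ->
  is_derive x v (@enorm R 2) ((x 0 0 * v 0 0 + x 1 0 * v 1 0) / enorm x).
Proof.
rewrite -enorm_gt0 => x0.
have s0 : 0 < x 0 0 * x 0 0 + x 1 0 * x 1 0.
  by rewrite -!expr2 -sqr_enorm exprn_gt0.
have d i := is_derive_coord x v i.
rewrite (_ : @enorm R 2 = fun x => Num.sqrt (x 0 0 * x 0 0 + x 1 0 * x 1 0)); last first.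
  by apply/funext => y; rewrite /enorm innerE.
have dq : is_derive x v (fun y : 'cV[R]_2 => y 0 0 * y 0 0 + y 1 0 * y 1 0) _
  := is_deriveD (is_deriveM (d 0) (d 0)) (is_deriveM (d 1) (d 1)).
have ds := is_derive_comp_real (f := fun y : 'cV[R]_2 => _) (is_derive1_sqrt s0) dq.
apply: (is_derive_eq ds).
 rewrite -!expr2 -sqr_enorm sqrtr_sqr ger0_norm ?enorm_ge0//.
rewrite /GRing.scale /=; field; exact: lt0r_neq0.
Qed.

End Plane.

(** * Radial terms *)

Section RadialProfile.
Variable R : realType.
Implicit Types (s u : R) (k n : nat).

(* [phi 0 s = chi s / s ^+ 2] and [phi k.+1 s = (phi k)^`() s / s], so that the
   gradient of [phi k (enorm x)] is [phi k.+1 (enorm x) *: x]; only [k <= 2]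
   is meaningful. The coefficients come from [p (s / (8 / 10))]. *)
Definition phi_in k s : R :=
  match k with
  | 0 => 625 / 32 * s - 75 * 125 / 256 * s ^+ 2 + 75 * 125 / 512 * s ^+ 3
  | 1 => 625 / 32 * (s ^+ 1)^-1 - 75 * 125 / 128 + 225 * 125 / 512 * s
  | _ => - (625 / 32) * (s ^+ 3)^-1 + 225 * 125 / 512 * (s ^+ 1)^-1
  end.

Definition phi_out k s : R :=
  match k with
  | 0 => (s ^+ 2)^-1
  | 1 => - 2 * (s ^+ 4)^-1
  | _ => 8 * (s ^+ 6)^-1
  end.

Definition phi k s : R := if s <= 8 / 10 then phi_in k s else phi_out k s.

Lemma is_derive_X n s : is_derive s 1 (fun y : R => y ^+ n) (n%:R * s ^+ n.-1).
Proof.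
constructor; first exact: exprn_derivable.
by rewrite exp_derive /GRing.scale /= mulr1.
Qed.

Lemma is_derive_invX n s : 0 < s ->
  is_derive s 1 (fun y : R => (y ^+ n)^-1) (- n%:R * (s ^+ n.+1)^-1).
Proof.
move=> s0; have sn0 : s ^+ n != 0 by rewrite expf_neq0// lt0r_neq0.
have d := is_deriveV (f := fun y : R => y ^+ n) sn0 (is_derive_X n s).
apply: (is_derive_eq d); rewrite /GRing.scale /=.
have s_neq0 := lt0r_neq0 s0.
case: n {d sn0} => [|n]; first by rewrite !(mul0r, oppr0, mulr0).
have -> : s ^+ n.+2 = s ^+ n * s ^+ 2 by rewrite -exprD addn2.
have -> : s ^+ n.+1 = s ^+ n * s by rewrite exprSr.
by field; rewrite s_neq0 expf_neq0.
Qed.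

Lemma is_derive_phi_in k s : 0 < s -> (k < 2)%N ->
  is_derive s 1 (phi_in k) (s * phi_in k.+1 s).
Proof.
move=> s0; case: k => [|[|//]] _ /=.
- have d := is_deriveD (is_deriveB (is_deriveZ (625 / 32) (is_derive_id s (1 : R)))
    (is_deriveZ (75 * 125 / 256) (is_derive_X 2 s)))
    (is_deriveZ (75 * 125 / 512) (is_derive_X 3 s)).
  apply: (is_derive_eq d); rewrite /GRing.scale /=; field; exact: lt0r_neq0.
- have d := is_deriveD (is_deriveB (is_deriveZ (625 / 32) (is_derive_invX 1 s s0))
    (is_derive_cst (75 * 125 / 128 : R) s (1 : R)))
    (is_deriveZ (225 * 125 / 512) (is_derive_id s (1 : R))).
  apply: (is_derive_eq d); rewrite /GRing.scale /=; field; exact: lt0r_neq0.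
Qed.

Lemma is_derive_phi_out k s : 0 < s -> (k < 2)%N ->
  is_derive s 1 (phi_out k) (s * phi_out k.+1 s).
Proof.
move=> s0; case: k => [|[|//]] _ /=.
- apply: (is_derive_eq (is_derive_invX 2 s s0)); field; exact: lt0r_neq0.
- have d := is_deriveZ (- 2) (is_derive_invX 4 s s0).
  apply: (is_derive_eq d); rewrite /GRing.scale /=; field; exact: lt0r_neq0.
Qed.

(** Since [p] takes the value 1 at 1 and its first two derivatives vanish there, [chi] meets the
    constant 1 to second order. *)
Lemma phi_glue k : phi_in k (8 / 10) = phi_out k (8 / 10).
Proof. by case: k => [|[|k]] /=; field. Qed.

Lemma is_derive_phi k s : 0 < s -> (k < 2)%N ->
  is_derive s 1 (phi k) (s * phi k.+1 s).
Proof.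
move=> s0 k2; apply: is_derive_glue (phi_glue k) => hs; rewrite /phi.
- by rewrite hs; exact: is_derive_phi_in.
(* At the seam itself [phi k.+1 s] unfolds to the inner branch, which [phi_glue] exchanges for the
   outer one. *)
- case: ifP => hs'; last exact: is_derive_phi_out.
  have -> : s = 8 / 10 by apply/eqP; rewrite eq_le hs hs'.
  by rewrite phi_glue; apply: is_derive_phi_out => //; lra.
Qed.

Lemma continuous_phi k s : 0 < s -> (k <= 2)%N -> {for s, continuous (phi k)}.
Proof.
move=> s0; rewrite leq_eqVlt => /orP[/eqP ->|k2]; last first.
  have [d _] := is_derive_phi k s s0 k2.
  exact/differentiable_continuous/derivable1_diffP.
have ci n : {for s, continuous (fun y : R => (y ^+ n)^-1)}.
  by have [d _] := is_derive_invX n s s0; exact/differentiable_continuous/derivable1_diffP.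
apply: continuous_glue (phi_glue 2) => _ /=.
- by apply: continuousD; apply: continuousM => //; exact: cst_continuous.
- by apply: continuousM => //; exact: cst_continuous.
Qed.

(** The first bound gives the order [1 - 2 * k] of [phi k] at the origin, the second its decay at
    infinity; 200 is a crude common constant. *)
Lemma phi_bound k s : 0 < s -> (k <= 2)%N ->
  `|phi k s| * s ^+ (2 * k) <= 200 * s /\ `|phi k s| * s ^+ (2 * k) * s ^+ 2 <= 200.
Proof.
move=> s0 k2; have sn0 : s != 0 by rewrite lt0r_neq0.
have -> : `|phi k s| * s ^+ (2 * k) = `|phi k s * s ^+ (2 * k)|.
  by rewrite normrM [X in _ = _ * X]ger0_norm// exprn_ge0// ltW.
rewrite /phi; case: ifPn => hs.
  (* The factor [s ^+ (2 * k)] clears the negative powers and leaves a polynomial divisible by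
     [s]. *)
  have h : `|phi_in k s * s ^+ (2 * k)| <= 138 * s.
    case: k k2 => [|[|[|//]]] _ /=; rewrite ler_norml; apply/andP; split.
    - by rewrite mulr1; nra.
    - by rewrite mulr1; nra.
    - have -> : (625 / 32 * (s ^+ 1)^-1 - 75 * 125 / 128 + 225 * 125 / 512 * s) * s ^+ (2 * 1)
        = 625 / 32 * s - 75 * 125 / 128 * s ^+ 2 + 225 * 125 / 512 * s ^+ 3 by field.
      nra.
    - have -> : (625 / 32 * (s ^+ 1)^-1 - 75 * 125 / 128 + 225 * 125 / 512 * s) * s ^+ (2 * 1)
        = 625 / 32 * s - 75 * 125 / 128 * s ^+ 2 + 225 * 125 / 512 * s ^+ 3 by field.
      nra.
    - have -> : (- (625 / 32) * (s ^+ 3)^-1 + 225 * 125 / 512 * (s ^+ 1)^-1) * s ^+ (2 * 2)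
        = - (625 / 32) * s + 225 * 125 / 512 * s ^+ 3 by field.
      nra.
    - have -> : (- (625 / 32) * (s ^+ 3)^-1 + 225 * 125 / 512 * (s ^+ 1)^-1) * s ^+ (2 * 2)
        = - (625 / 32) * s + 225 * 125 / 512 * s ^+ 3 by field.
      nra.
  split; first by apply: le_trans h _; lra.
  apply: (@le_trans _ _ (138 * s * s ^+ 2)); first by rewrite ler_wpM2r// sqr_ge0.
  by nra.
rewrite -ltNge in hs.
(* Outside, the product is constant: 1, -2 or 8 before taking absolute values. *)
have h : `|phi_out k s * s ^+ (2 * k)| * s ^+ 2 <= 8.
  have -> : `|phi_out k s * s ^+ (2 * k)| * s ^+ 2 = `|phi_out k s * s ^+ (2 * k) * s ^+ 2|.
    by rewrite [RHS]normrM (ger0_norm (sqr_ge0 s)).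
  rewrite ler_norml.
  case: k k2 => [|[|[|//]]] _ /=.
  - by have -> : (s ^+ 2)^-1 * s ^+ (2 * 0) * s ^+ 2 = 1; [field|lra].
  - by have -> : - 2 * (s ^+ 4)^-1 * s ^+ (2 * 1) * s ^+ 2 = - 2; [field|lra].
  - by have -> : 8 * (s ^+ 6)^-1 * s ^+ (2 * 2) * s ^+ 2 = 8; [field|lra].
split; last lra.
rewrite -(ler_pM2r (exprn_gt0 2 s0)); apply: le_trans h _.
have : (8/10) ^+ 3 <= s ^+ 3 by rewrite lerXn2r ?nnegrE// ?ltW//; lra.
by nra.
Qed.

Lemma phi0_sqr s : 0 < s -> phi 0 s * s ^+ 2 = chi s.
Proof.
move=> s0; rewrite /phi /chi; case: ifP => _ /=.
  by rewrite /p; field.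
by rewrite mulVf// expf_neq0// lt0r_neq0.
Qed.

End RadialProfile.

(** * Growth, continuity and derivatives of radial profiles times monomials *)

Section RadialTerm.
Variable R : realType.
Implicit Types (x y v : 'cV[R]_2) (s : R) (i j k n : nat).

Definition mono i j x : R := x 0 0 ^+ i * x 1 0 ^+ j.

Definition term k i j x : R := phi R k (enorm x) * mono i j x.

Lemma is_derive_mono i j x v : is_derive x v (mono i j)
  (v 0 0 * (i%:R * mono i.-1 j x) + v 1 0 * (j%:R * mono i j.-1 x)).
Proof.
have d n (l : 'I_2) := is_derive_comp_real (f := fun y : 'cV[R]_2 => y l 0)
  (is_derive_X R n (x l 0)) (is_derive_coord R x v l).
apply: (is_derive_eq (is_deriveM (d i 0) (d j 1))).
by rewrite /mono /GRing.scale /=; ring.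
Qed.

Lemma mono_bound i j x : `|mono i j x| <= enorm x ^+ (i + j).
Proof.
by rewrite normrM !normrX exprD ler_pM ?exprn_ge0// lerXn2r ?nnegrE ?enorm_ge0//
  coord_le_enorm.
Qed.

(** If [i + j > 0] the monomial vanishes, whatever value the convention [0^-1 = 0] gives to
    [phi k 0]. Otherwise [k = 0] and the profile itself vanishes. *)
Lemma term0 k i j : (k <= 2)%N -> (2 * k <= i + j)%N -> term k i j 0 = 0.
Proof.
rewrite /term /mono !mxE enorm0 !expr0n => k2.
case: i => [|i]; last by rewrite mul0r mulr0.
case: j => [|j]; last by rewrite mulr0 mulr0.
case: k k2 => [|k] // _ _; rewrite /phi ifT; last lra.
by rewrite /= !expr0n /= !mulr0 subr0 addr0 mul0r.
Qed.

(* At the origin, [term k i j] is of order [i + j + 1 - 2 * k]. *)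
Lemma term_bound k i j x : (k <= 2)%N ->
  (2 * k <= i + j <= 2 * k + 2)%N -> `|term k i j x| <= 200 * enorm x.
Proof.
move=> k2 /andP[l u]; have [->|x0] := eqVneq x 0.
  by rewrite term0// enorm0 mulr0 normr0.
rewrite -enorm_gt0 in x0; have [b1 b2] := phi_bound R k _ x0 k2.
rewrite /term normrM; apply: le_trans (ler_wpM2l (normr_ge0 _) (mono_bound i j x)) _.
have ij : (i + j = 2 * k + 2 \/ i + j = 2 * k + 1 \/ i + j = 2 * k)%N by lia.
set a := _ * _ in b1 b2; have a0 : 0 <= a by rewrite mulr_ge0// exprn_ge0// ltW.
case: ij => [|[|]] ->; rewrite ?(exprD _ (2 * k)%N 2) ?(exprD _ (2 * k)%N 1) ?mulrA -/a;
  set s := enorm x in x0 b1 b2 *.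
(* The bound [b1] settles [s <= 1] and the decay bound [b2] settles [s > 1]. *)
- have [s1|s1] := leP s 1; last by nra.
  have h : 0 <= 1 - s ^+ 2 by nra.
  by have := mulr_ge0 a0 h; nra.
- rewrite expr1; have [s1|s1] := leP s 1; first by nra.
  have h : 0 <= s ^+ 2 - s by nra.
  by have := mulr_ge0 a0 h; nra.
- exact: b1.
Qed.

(** One more degree in the monomial raises the order at the origin to two, as needed for a zero
    derivative there. *)
Lemma term_bound_sqr k i j x : (k <= 2)%N ->
  (2 * k + 1 <= i + j <= 2 * k + 2)%N -> `|term k i j x| <= 200 * enorm x ^+ 2.
Proof.
move=> k2 /andP[l u]; have [->|x0] := eqVneq x 0.
  rewrite term0//; last by apply: leq_trans l; rewrite leq_addr.
  by rewrite enorm0 expr0n mulr0 normr0.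
rewrite -enorm_gt0 in x0; have [b1 b2] := phi_bound R k _ x0 k2.
rewrite /term normrM; apply: le_trans (ler_wpM2l (normr_ge0 _) (mono_bound i j x)) _.
have ij : (i + j = 2 * k + 1 \/ i + j = 2 * k + 2)%N by lia.
set a := _ * _ in b1 b2; have a0 : 0 <= a by rewrite mulr_ge0// exprn_ge0// ltW.
case: ij => ->; rewrite ?(exprD _ (2 * k)%N 2) ?(exprD _ (2 * k)%N 1) mulrA -/a; set s := enorm x in x0 b1 b2 *.
  by rewrite expr1; nra.
have [s1|s1] := leP s 1; last by nra.
rewrite ler_pM2r ?exprn_gt0//; nra.
Qed.

(** This is the degree of the summands in the gradient of [term 0 i j] with [i + j = 2], so that
    gradient is bounded on the whole plane. *)
Lemma term_bounded k i j x : (k <= 2)%N -> (i + j = 2 * k + 1)%N ->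
  `|term k i j x| <= 200.
Proof.
move=> k2 ij; have [->|x0] := eqVneq x 0.
  by rewrite term0// ?ij ?leq_addr// normr0.
rewrite -enorm_gt0 in x0; have [b1 b2] := phi_bound R k _ x0 k2.
rewrite /term normrM; apply: le_trans (ler_wpM2l (normr_ge0 _) (mono_bound i j x)) _.
rewrite ij (exprD _ (2 * k)%N) mulrA expr1.
set a := _ * _ in b1 b2 *; have a0 : 0 <= a by rewrite mulr_ge0// exprn_ge0// ltW.
by have [s1|s1] := leP (enorm x) 1; nra.
Qed.

Lemma continuous_term k i j : (k <= 2)%N -> (2 * k <= i + j <= 2 * k + 2)%N ->
  continuous (term k i j).
Proof.
move=> k2 kij x; have [->|x0] := eqVneq x 0; last first.
  apply: (@continuousM _ _ (fun y => phi R k (enorm y)) (mono i j)).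
    apply: (@continuous_comp _ _ _ (@enorm R 2) (phi R k)).
      exact: continuous_enorm.
    by apply: continuous_phi => //; rewrite enorm_gt0.
  have cX n (l : 'I_2) : {for x, continuous (fun y : 'cV[R]_2 => y l 0 ^+ n)}.
    apply: (@continuous_comp _ _ _ (fun y : 'cV[R]_2 => y l 0) (fun u : R => u ^+ n)).
      exact: coord_continuous.
    exact: exprn_continuous.
  exact: (continuousM (cX i 0) (cX j 1)).
case/andP: (kij) => l _.
apply: (@continuous_squeeze _ _ _ _ (fun y => 200 * enorm y)).
- by move=> y; rewrite term0// sub0r normrN; exact: term_bound.
- by rewrite enorm0 mulr0.
- apply: (@continuousM _ _ (cst 200) (@enorm R 2)); first exact: cst_continuous.
  exact: continuous_enorm.
Qed.

(** The first summand in each bracket differentiates the profile, the second the monomial. When an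
    exponent is 0, its truncated predecessor comes with the coefficient 0. *)
Definition dterm k i j v x : R :=
  v 0 0 * (term k.+1 i.+1 j x + i%:R * term k i.-1 j x)
  + v 1 0 * (term k.+1 i j.+1 x + j%:R * term k i j.-1 x).

Lemma is_derive_term k i j x v : (k < 2)%N ->
  (2 * k + 1 <= i + j <= 2 * k + 2)%N ->
  is_derive x v (term k i j) (dterm k i j v x).
Proof.
move=> k2 kij; have [->|x0] := eqVneq x 0; last first.
  have s0 : 0 < enorm x by rewrite enorm_gt0.
  have d := is_derive_comp_real (is_derive_phi R k _ s0 k2) (is_derive_enorm R x v x0).
  apply: (is_derive_eq (is_deriveM d (is_derive_mono i j x v))).
  rewrite /dterm /term /mono /GRing.scale /= !exprS; field; exact: lt0r_neq0.
have -> : dterm k i j v 0 = 0.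
  rewrite /dterm !(term0 k.+1)//; try lia.
  have -> : i%:R * term k i.-1 j 0 = 0.
    by case: i kij => [|i] kij; rewrite ?mul0r// term0 ?mulr0//; lia.
  have -> : j%:R * term k i j.-1 0 = 0.
    by case: j kij => [|j] kij; rewrite ?mul0r// term0 ?mulr0//; lia.
  by rewrite !addr0 !mulr0 addr0.
(* The constant is 200 times the square of the factor 2 in [enorm_le_norm]. *)
apply: (@is_derive_quadratic _ _ _ _ _ _ 800) => y.
rewrite term0 ?subr0; last 2 first.
- exact: ltnW.
- by case/andP: kij => l _; apply: leq_trans l; rewrite leq_addr.
apply: le_trans (term_bound_sqr _ _ _ _ (ltnW k2) kij) _.
have := enorm_le_norm R y; have := enorm_ge0 R y; nra.
Qed.

End RadialTerm.

(** * Regularity of the metric *)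

Section SecondOrder.
Variables (R : realType) (n : nat).

Lemma C2_cst {V : normedModType R} (c : V) : C2 (fun _ : 'cV[R]_n => c).
Proof.
have D (v : 'cV[R]_n) (a : V) : 'D_v (fun _ : 'cV[R]_n => a) = fun _ => 0.
  by apply/funext => x; rewrite derive_cst.
split.
- exact: cst_continuous.
- move=> i; rewrite D; split; last exact: cst_continuous.
  by move=> x; exact: derivable_cst.
- move=> i j; rewrite !D; split; last exact: cst_continuous.
  by move=> x; exact: derivable_cst.
Qed.

Lemma C2_add {V : normedModType R} (f g : 'cV[R]_n -> V) :
  C2 f -> C2 g -> C2 (fun x => f x + g x).
Proof.
move=> [cf df ddf] [cg dg ddg].
have D v (f' g' : 'cV[R]_n -> V) : (forall x, derivable f' x v) ->
    (forall x, derivable g' x v) ->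
    'D_v (fun x => f' x + g' x) = fun x => 'D_v f' x + 'D_v g' x.
  by move=> hf hg; apply/funext => x; exact: deriveD.
split.
- by move=> x; exact: (continuousD (cf x) (cg x)).
- move=> i; have [fi cfi] := df i; have [gi cgi] := dg i; split.
    by move=> x; exact: derivableD.
  by rewrite D// => x; exact: (continuousD (cfi x) (cgi x)).
- move=> i j; have [fi cfi] := df j; have [gi cgi] := dg j.
  have [fij cfij] := ddf i j; have [gij cgij] := ddg i j.
  rewrite (D _ _ _ fi gi); split; first by move=> x; exact: derivableD.
  by rewrite (D _ _ _ fij gij) => x; exact: (continuousD (cfij x) (cgij x)).
Qed.

Lemma C2_scalel {V : normedModType R} (f : 'cV[R]_n -> R) (c : V) :
  C2 f -> C2 (fun x => f x *: c).
Proof.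
move=> [cf df ddf].
have cZ (g : 'cV[R]_n -> R) : continuous g -> continuous (fun x => g x *: c).
  by move=> cg x; exact: (cvgZr_tmp (cg x)).
have dZ v (g : 'cV[R]_n -> R) x : derivable g x v -> derivable (fun x => g x *: c) x v.
  by move=> /derivableP h; have [] := is_derive_scalel c h.
have D v (g : 'cV[R]_n -> R) : (forall x, derivable g x v) ->
    'D_v (fun x => g x *: c) = fun x => 'D_v g x *: c.
  move=> hg; apply/funext => x.
  by have [_ ->] := is_derive_scalel c (derivableP (hg x)).
split.
- exact: cZ.
- move=> i; have [fi cfi] := df i; split; first by move=> x; exact: dZ.
  by rewrite D//; exact: cZ.
- move=> i j; have [fi cfi] := df j; have [fij cfij] := ddf i j.
  rewrite (D _ _ fi); split; first by move=> x; exact: dZ.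
  by rewrite (D _ _ fij); exact: cZ.
Qed.

End SecondOrder.

(** * Quadratic radial terms and the expansion of the metric *)

Section Metric.
Variable R : realType.
Implicit Types (x y v : 'cV[R]_2) (i j k : nat).

Lemma continuous_dterm k i j v : (k < 2)%N ->
  (2 * k + 1 <= i + j <= 2 * k + 2)%N -> continuous (dterm R k i j v).
Proof.
move=> k2 kij x.
have ct k' i' j' : (k' <= 2)%N -> (2 * k' <= i' + j' <= 2 * k' + 2)%N ->
    {for x, continuous (term R k' i' j')}.
  by move=> h h'; exact: continuous_term.
have cZ (a : R) (f : 'cV[R]_2 -> R) : {for x, continuous f} ->
    {for x, continuous (fun y => a * f y)}.
  by move=> cf; exact: (continuousM (@cst_continuous _ _ a x) cf).
have cD (f g : 'cV[R]_2 -> R) : {for x, continuous f} -> {for x, continuous g} ->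
    {for x, continuous (fun y => f y + g y)}.
  exact: continuousD.
by apply: (cD); apply: (cZ); apply: (cD); [|apply: (cZ)| |apply: (cZ)]; apply: ct; lia.
Qed.

Definition ddterm i j v w x : R :=
  v 0 0 * (dterm R 1 i.+1 j w x + i%:R * dterm R 0 i.-1 j w x)
  + v 1 0 * (dterm R 1 i j.+1 w x + j%:R * dterm R 0 i j.-1 w x).

(** Up to summands with coefficient zero, each differentiation lowers the surplus [i + j - 2 * k] by
    one. From 2 it drops to 1, which still allows a derivative, and then to 0, which still gives
    continuity. *)
Lemma is_derive_dterm i j v w x : (i + j = 2)%N ->
  is_derive x w (dterm R 0 i j v) (ddterm i j v w x).
Proof.
move=> ij.
have dt k' i' j' : (k' < 2)%N -> (2 * k' + 1 <= i' + j' <= 2 * k' + 2)%N ->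
    is_derive x w (term R k' i' j') (dterm R k' i' j' w x).
  by move=> h h'; exact: is_derive_term.
have dZ (a d : R) (f : 'cV[R]_2 -> R) : is_derive x w f d ->
    is_derive x w (fun y => a * f y) (a * d).
  by move=> df; exact: (is_deriveZ a df).
have dD (f g : 'cV[R]_2 -> R) (a b : R) : is_derive x w f a -> is_derive x w g b ->
    is_derive x w (fun y => f y + g y) (a + b).
  by move=> df dg; exact: (is_deriveD df dg).
by apply: (dD); apply: (dZ); apply: (dD); [|apply: (dZ)| |apply: (dZ)]; apply: dt; lia.
Qed.

Lemma continuous_ddterm i j v w : (i + j = 2)%N -> continuous (ddterm i j v w).
Proof.
move=> ij x.
have ct k' i' j' : (k' < 2)%N -> (2 * k' + 1 <= i' + j' <= 2 * k' + 2)%N ->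
    {for x, continuous (dterm R k' i' j' w)}.
  by move=> h h'; exact: continuous_dterm.
have cZ (a : R) (f : 'cV[R]_2 -> R) : {for x, continuous f} ->
    {for x, continuous (fun y => a * f y)}.
  by move=> cf; exact: (continuousM (@cst_continuous _ _ a x) cf).
have cD (f g : 'cV[R]_2 -> R) : {for x, continuous f} -> {for x, continuous g} ->
    {for x, continuous (fun y => f y + g y)}.
  exact: continuousD.
by apply: (cD); apply: (cZ); apply: (cD); [|apply: (cZ)| |apply: (cZ)]; apply: ct; lia.
Qed.

Lemma C2_term i j : (i + j = 2)%N -> C2 (term R 0 i j).
Proof.
move=> ij.
have D v : 'D_v (term R 0 i j) = dterm R 0 i j v.
  by apply/funext => x; have [_] := is_derive_term R 0 i j x v isT ltac:(lia).
have DD v w : 'D_w (dterm R 0 i j v) = ddterm i j v w.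
  by apply/funext => x; have [_] := is_derive_dterm i j v w x ij.
split.
- by apply: continuous_term => //; lia.
- move=> l; rewrite D; split; last by apply: continuous_dterm => //; lia.
  by move=> x; have [] := is_derive_term R 0 i j x (unit_vec R l) isT ltac:(lia).
- move=> l m; rewrite D DD; split; last exact: continuous_ddterm.
  by move=> x; have [] := is_derive_dterm i j (unit_vec R m) (unit_vec R l) x ij.
Qed.

(** The mean value theorem on the segment from [y] to [x], with a global bound on the gradient. *)
Lemma term_lipschitz i j x y : (i + j = 2)%N ->
  `|term R 0 i j x - term R 0 i j y| <= 1200 * enorm (x - y).
Proof.
move=> ij; set v := x - y.
(* Each of the two coordinates contributes at most [200 + 2 * 200] times [enorm v], the inner factor
   2 being the largest exponent. *)
have bd z : `|dterm R 0 i j v z| <= 1200 * enorm v.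
  have b k' i' j' : (k' <= 2)%N -> (i' + j' = 2 * k' + 1)%N ->
      `|term R k' i' j' z| <= 200 by exact: term_bounded.
  have bn m i' j' : (m <= 2)%N -> (m = 0 \/ i' + j' = 1)%N ->
      `|m%:R * term R 0 i' j' z| <= 400.
    move=> m2 [->|h]; first by rewrite mul0r normr0 ler0n.
    rewrite normrM normr_nat (_ : 400 = 2 * 200); last ring.
    by rewrite ler_pM// ?ler_nat// b.
  have h0 := coord_le_enorm R v 0; have h1 := coord_le_enorm R v 1.
  have c (a t m t' : R) : `|a| <= enorm v -> `|t| <= 200 -> `|m * t'| <= 400 ->
      `|a * (t + m * t')| <= 600 * enorm v.
    move=> ha ht hm; rewrite normrM mulrC ler_pM//.
    by apply: le_trans (ler_normD _ _) _; lra.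
  apply: le_trans (ler_normD _ _) _.
  have -> : 1200 * enorm v = 600 * enorm v + 600 * enorm v by ring.
  by apply: lerD; apply: (c) => //; first [apply: b; lia | apply: bn; lia].
have d (t : R) : is_derive t 1 (fun h : R => term R 0 i j (h *: v + y))
    (dterm R 0 i j v (t *: v + y)).
  by apply/is_derive_line; apply: is_derive_term => //; lia.
have cont : {within `[0, 1], continuous (fun h : R => term R 0 i j (h *: v + y))}.
  apply/continuous_subspaceT => t; apply/differentiable_continuous/derivable1_diffP.
  by case: (d t).
have [c _ E] := MVT ltr01 (fun t _ => d t) cont.
move: E; rewrite scale1r scale0r add0r subrK subr0 mulr1 => ->; exact: bd.
Qed.

(** Together with the next two matrices, the coefficients of [x_0^2], [x_0 x_1] and [x_1^2] in
    [|x|^2 (Rot B Rot^T - 1)]. *)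
Definition MMc20 : 'M[R]_2 := mx2 0 (- (1 / 2)) (- (1 / 2)) (- (1 / 2)).
Definition MMc11 : 'M[R]_2 := mx2 1 (1 / 2) (1 / 2) (-1).
Definition MMc02 : 'M[R]_2 := mx2 (- (1 / 2)) (1 / 2) (1 / 2) 0.

Lemma RotE x : x != 0 -> Rot x = (enorm x)^-1 *: mx2 (x 0 0) (- x 1 0) (x 1 0) (x 0 0).
Proof.
move=> x0; have e (a : 'cV[R]_2) b l : (row_mx a b : 'M[R]_(2, 1 + 1)) l 0 = a l 0.
  by rewrite -(row_mxEl a b l 0); congr (row_mx a b l _); exact/val_inj.
have e' (a : 'cV[R]_2) b l : (row_mx a b : 'M[R]_(2, 1 + 1)) l 1 = b l 0.
  by rewrite -(row_mxEr a b l 0); congr (row_mx a b l _); exact/val_inj.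
apply: M2_eq; rewrite /Rot ?e ?e' /e_theta /J /e_r ?mulmx2E ?mx2E [RHS]mxE ?mx2E
  ?mxE; ring.
Qed.

(** The factor [s^2] in [chi s = phi 0 s * s ^+ 2] cancels the two normalizations in [Rot]; the
    polar angle and the case split at the origin disappear. *)
Lemma MME : @MM R = fun x => 1%:M + term R 0 2 0 x *: MMc20
  + term R 0 1 1 x *: MMc11 + term R 0 0 2 x *: MMc02.
Proof.
apply/funext => x; have [->|x0] := eqVneq x 0.
  by rewrite /MM eqxx !term0// !scale0r !addr0.
have s0 : enorm x != 0 by rewrite lt0r_neq0// enorm_gt0.
rewrite /MM (negbTE x0) RotE// linearZ/= -scalemxAl -scalemxAr -scalemxAl !scalerA.
rewrite -phi0_sqr ?enorm_gt0//.
have -> : phi R 0 (enorm x) * enorm x ^+ 2 * ((enorm x)^-1 / enorm x) = phi R 0 (enorm x).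
  by field.
rewrite sqr_enorm /term /mono !expr0 !expr1 !mulr1 !mul1r.
have DE (A A' : 'M[R]_2) p q : (A + A') p q = A p q + A' p q by rewrite mxE.
have ZE c (A : 'M[R]_2) p q : (c *: A) p q = c * A p q by rewrite mxE.
have TE (A : 'M[R]_2) p q : A^T p q = A q p by rewrite mxE.
have IE p q : (1%:M : 'M[R]_2) p q = (p == q)%:R by rewrite mxE.
by apply: M2_eq; rewrite !(DE, ZE, mulmx2E, TE, mx2E, IE) /=; field.
Qed.

End Metric.

(** * Smoothness, Lipschitz bound and uniform definiteness of the metric *)

Section MetricProperties.
Variable R : realType.
Implicit Types (x y v w : 'cV[R]_2) (s : R).

Lemma enorm_le_abs x : enorm x <= `|x 0 0| + `|x 1 0|.
Proof.
rewrite enorm_le_sqr ?addr_ge0// -(real_normK (num_real (x 0 0))).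
rewrite -(real_normK (num_real (x 1 0))).
have := mulr_ge0 (normr_ge0 (x 0 0)) (normr_ge0 (x 1 0)); nra.
Qed.

Lemma C2_MM : C2 (@MM R).
Proof.
rewrite MME; apply: C2_add; last exact: C2_scalel (C2_term _ _ _ _).
apply: C2_add; last exact: C2_scalel (C2_term _ _ _ _).
apply: C2_add; last exact: C2_scalel (C2_term _ _ _ _).
exact: C2_cst.
Qed.

Lemma matrix_lipschitz_MM : matrix_lipschitz (@MM R).
Proof.
exists (6 * 1200) => x y v.
set d := 1200 * enorm (x - y); set V := enorm v.
(* Each output coordinate costs [3 * (d * V)]: the absolute row sums of the three coefficient
   matrices are 1/2, 3/2, 1 in the first row and 1, 3/2, 1/2 in the second. *)
have -> : 6 * 1200 * enorm (x - y) * V = 3 * (d * V) + 3 * (d * V) by rewrite /d; ring.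
have h (a w : R) c : `|a| <= d -> `|w| <= c * V -> `|a * w| <= d * (c * V).
  by move=> ha hw; rewrite normrM ler_pM.
have l i j : (i + j = 2)%N -> `|term R 0 i j x - term R 0 i j y| <= d.
  exact: term_lipschitz.
have := l 2 0 erefl; have := l 1 1 erefl; have := l 0 2 erefl.
set D02 := _ - term _ _ 0 2 y; set D11 := _ - term _ _ 1 1 y; set D20 := _ - term _ _ 2 0 y.
move=> l02 l11 l20.
have -> : MM x - MM y = D20 *: MMc20 R + D11 *: MMc11 R + D02 *: MMc02 R.
  by rewrite MME /D20 /D11 /D02 !scalerBl; apply/matrixP => p q; rewrite !mxE; ring.
have := coord_le_enorm R v 0; have := coord_le_enorm R v 1; rewrite -/V.
rewrite !ler_norml => /andP[v1l v1u] /andP[v0l v0u].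
apply: le_trans (enorm_le_abs _) _; apply: lerD; rewrite mulmx2E !mxE /=.
- have h20 : `|D20 * - (1 / 2 * v 1 0)| <= d * (1 / 2 * V).
    by apply: (h) => //; rewrite ler_norml; lra.
  have h11 : `|D11 * (v 0 0 + 1 / 2 * v 1 0)| <= d * (3 / 2 * V).
    by apply: (h) => //; rewrite ler_norml; lra.
  have h02 : `|D02 * (1 / 2 * v 1 0 - 1 / 2 * v 0 0)| <= d * (1 * V).
    by apply: (h) => //; rewrite ler_norml; lra.
  by move: h20 h11 h02; rewrite !ler_norml; lra.
- have h20 : `|D20 * - (1 / 2 * v 0 0 + 1 / 2 * v 1 0)| <= d * (1 * V).
    by apply: (h) => //; rewrite ler_norml; lra.
  have h11 : `|D11 * (1 / 2 * v 0 0 - v 1 0)| <= d * (3 / 2 * V).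
    by apply: (h) => //; rewrite ler_norml; lra.
  have h02 : `|D02 * (1 / 2 * v 0 0)| <= d * (1 / 2 * V).
    by apply: (h) => //; rewrite ler_norml; lra.
  by move: h20 h11 h02; rewrite !ler_norml; lra.
Qed.

Lemma is_diff_MM0 : is_diff (0 : 'cV[R]_2) (@MM R) 0.
Proof.
apply: (@is_diff_quadratic _ _ _ _ _
  (800 * (`|MMc20 R| + `|MMc11 R| + `|MMc02 R|))) => y.
have t i j (C : 'M[R]_2) : (i + j = 2)%N ->
    `|term R 0 i j y *: C| <= 800 * `|y| ^+ 2 * `|C|.
  move=> ij; rewrite normrZ ler_wpM2r//.
  apply: le_trans (term_bound_sqr R 0 i j y isT ltac:(lia)) _.
  have := enorm_le_norm R y; have := enorm_ge0 R y; nra.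
rewrite MME !(term0 R 0)// !scale0r !addr0 subr0 -!addrA addrC -!addrA addNr addr0.
apply: le_trans (ler_normD _ _) _.
have := ler_normD (term R 0 1 1 y *: MMc11 R) (term R 0 0 2 y *: MMc02 R).
have := t 2 0 (MMc20 R) erefl; have := t 1 1 (MMc11 R) erefl.
have := t 0 2 (MMc02 R) erefl; nra.
Qed.

Lemma chi_itv s : 0 < s -> 0 <= chi s <= 1.
Proof.
move=> s0; rewrite /chi; case: ifP => [s1|_]; last by rewrite ler01 lexx.
have u0 : 0 <= s / (8 / 10) by rewrite divr_ge0//; lra.
have u1 : s / (8 / 10) <= 1 by rewrite ler_pdivrMr; lra.
move: (s / _) u0 u1 => u u0 u1.
(* The polynomial [p] has a triple zero at 0 and [1 - p] one at 1; both cofactors are positive on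
   the unit interval. *)
have pE : p u = u ^+ 3 * (10 - 15 * u + 6 * u ^+ 2) by rewrite /p; ring.
have pE' : 1 - p u = (1 - u) ^+ 3 * (1 + 3 * u + 6 * u ^+ 2) by rewrite /p; ring.
apply/andP; split; last rewrite -subr_ge0.
- by rewrite pE mulr_ge0 ?exprn_ge0//; nra.
- by rewrite pE' mulr_ge0 ?exprn_ge0//; nra.
Qed.

(** [MM x] is a convex combination of the identity and a rotated copy of [B], whose least eigenvalue
    [(3 - sqrt 5) / 4] exceeds 1/10. *)
Lemma MM_form_ge x (a b : R) :
  1 / 10 * (a ^+ 2 + b ^+ 2) <=
  a * (MM x 0 0 * a + MM x 0 1 * b) + b * (MM x 1 0 * a + MM x 1 1 * b).
Proof.
have [->|x0] := eqVneq x 0.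
  rewrite /MM eqxx !mxE /=; have := sqr_ge0 a; have := sqr_ge0 b; nra.
rewrite -enorm_gt0 in x0.
have s0 := exprn_gt0 2 x0.
have := chi_itv _ x0; rewrite -phi0_sqr// => /andP[c0 c1].
have f0 : 0 <= phi R 0 (enorm x) by rewrite -(pmulr_lge0 _ s0).
rewrite MME !mxE /= /term /mono !expr0 !expr1 !mulr1 !mul1r.
move: c0 c1; rewrite sqr_enorm; move: (phi _ _ _) f0 => f f0.
move: (x 0 0) (x 1 0) => u v c0 c1.
(* Up to the factor [|x|], the components of [(a, b)] along [e_r] and [e_theta]. *)
set m := a * u + b * v; set n := b * u - a * v.
set sg := u ^+ 2 + v ^+ 2 in c0 c1 *.
have mn : m ^+ 2 + n ^+ 2 = sg * (a ^+ 2 + b ^+ 2) by rewrite /m /n /sg; ring.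
have q : 0 <= f * (9 / 10 * m ^+ 2 - m * n + 4 / 10 * n ^+ 2).
  rewrite mulr_ge0//.
  have -> : 9 / 10 * m ^+ 2 - m * n + 4 / 10 * n ^+ 2
    = 2 / 5 * (n - 5 / 4 * m) ^+ 2 + 11 / 40 * m ^+ 2 by field.
  by rewrite addr_ge0// mulr_ge0 ?sqr_ge0//; lra.
have r : 0 <= 9 / 10 * ((1 - f * sg) * (a ^+ 2 + b ^+ 2)).
  by rewrite !mulr_ge0 ?subr_ge0 ?addr_ge0 ?sqr_ge0//; lra.
rewrite -subr_ge0; apply: (eq_ind _ (fun z => 0 <= z) (addr_ge0 q r)).
by rewrite /m /n /sg; field.
Qed.

Lemma MM_sym x : (MM x)^T = MM x.
Proof. by rewrite MME; apply: M2_eq; rewrite !mxE /=. Qed.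

Lemma uniformly_posdef_MM : uniformly_posdef (@MM R).
Proof.
exists (1 / 10); first lra.
move=> x; split; first exact: MM_sym.
(* The eigenvector is a row [v]; pairing [v *m MM x] with [v] gives the quadratic form bounded
   above. *)
move=> a /eigenvalueP[v vM v0].
have e0 : (v *m MM x) 0 0 = a * v 0 0 by rewrite vM mxE.
have e1 : (v *m MM x) 0 1 = a * v 0 1 by rewrite vM mxE.
rewrite !mulmx2E in e0 e1.
have n0 : 0 < v 0 0 ^+ 2 + v 0 1 ^+ 2.
  rewrite lt_def addr_ge0 ?sqr_ge0// andbT; apply: contra v0.
  rewrite paddr_eq0 ?sqr_ge0// !sqrf_eq0 => /andP[/eqP v00 /eqP v01].
  apply/eqP/matrixP => i j; rewrite (ord1 i) mxE.
  by case: (ord2P j) => ->.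
rewrite -(ler_pM2r n0); apply: (eq_ind _ (fun z => _ <= z) (MM_form_ge x (v 0 0) (v 0 1))).
have -> : a * (v 0 0 ^+ 2 + v 0 1 ^+ 2) = v 0 0 * (a * v 0 0) + v 0 1 * (a * v 0 1) by ring.
by rewrite -e0 -e1; ring.
Qed.

End MetricProperties.

(** * The flow and the inverse metric *)

Section Dynamics.
Variable R : realType.
Implicit Types (x y v w : 'cV[R]_2) (s : R).

(** [J] is skew, so [2 J] drops out of the inner product and equality holds. *)
Lemma strongly_monotone_F : strongly_monotone 1 (@Sball R) (@F R).
Proof.
move=> x y _ _; rewrite sqr_enorm innerE /F -mulmxBr.
set z := x - y; rewrite !mulmx2E /J !mxE /=.
by rewrite -subr_ge0; apply: (eq_ind _ (fun u => 0 <= u) (lexx 0)); ring.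
Qed.

Lemma elipschitz_F : elipschitz (Num.sqrt 5) (@F R).
Proof.
move=> x y; rewrite /F -mulmxBr; set z := x - y.
rewrite enorm_le_sqr ?mulr_ge0 ?sqrtr_ge0 ?enorm_ge0// exprMn sqr_sqrtr//.
rewrite sqr_enorm !mulmx2E /J !mxE /=.
by rewrite -subr_ge0; apply: (eq_ind _ (fun u => 0 <= u) (lexx 0)); ring.
Qed.

Lemma VI_solution_F0 : VI_solution (@F R) (@Sball R) 0.
Proof.
split; first by rewrite /Sball /= enorm0; lra.
by move=> y _; rewrite /F mulmx0 innerE !mxE !mul0r addr0.
Qed.

(** Testing the inequality at the origin gives [0 <= - |x|^2], again because [J] is skew. *)
Lemma VI_solution_F_eq0 x : VI_solution (@F R) (@Sball R) x -> x = 0.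
Proof.
move=> [_ /(_ 0)]; rewrite /Sball /= enorm0 => /(_ ltac:(lra)).
rewrite sub0r innerE /F !mulmx2E /J !mxE /= => h.
apply: enorm0_eq0; apply: enorm_eq_sqr => //.
apply/eqP; rewrite expr0n /= eq_le addr_ge0 ?sqr_ge0// andbT.
by rewrite -oppr_ge0; apply: (eq_ind _ (fun u => 0 <= u) h); ring.
Qed.

Lemma posdef_B : posdef (B R).
Proof.
split; first by apply: M2_eq; rewrite !mxE.
move=> x; rewrite -enorm_gt0 => x0; have := exprn_gt0 2 x0; rewrite sqr_enorm.
rewrite innerE !mulmx2E /B !mx2E; move: (x 0 0) (x 1 0) => a b ab.
have := sqr_ge0 (3 * a - 2 * b); have := sqr_ge0 (a - b); nra.
Qed.

(** For [x != 0] this is [Rot B^-1 Rot^T], where [B^-1] has rows [(2, 2)] and [(2, 4)], with the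
    multiple 2 of the identity split off. *)
Definition MMinv x : 'M[R]_2 :=
  2 *: 1%:M + (2 / enorm x ^+ 2) *:
    mx2 (x 1 0 ^+ 2 - 2 * x 0 0 * x 1 0)
        (x 0 0 ^+ 2 - x 1 0 ^+ 2 - x 0 0 * x 1 0)
        (x 0 0 ^+ 2 - x 1 0 ^+ 2 - x 0 0 * x 1 0)
        (x 0 0 ^+ 2 + 2 * x 0 0 * x 1 0).

Lemma phi0_out s : 8 / 10 <= s -> phi R 0 s = (s ^+ 2)^-1.
Proof.
move=> hs; rewrite /phi; case: ifP => // hs'.
have -> : s = 8 / 10 by apply/eqP; rewrite eq_le hs hs'.
exact: phi_glue.
Qed.

Lemma MM_out_mul x : 8 / 10 <= enorm x -> MM x *m MMinv x = 1%:M.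
Proof.
move=> hx; have s0 : enorm x ^+ 2 != 0 by rewrite expf_neq0// lt0r_neq0//; lra.
rewrite MME /term phi0_out// /MMinv /mono.
move: s0; rewrite sqr_enorm => s0.
by apply: M2_eq; rewrite !(mulmx2E, entryE, mx2E) /=; field.
Qed.

Lemma invmx_MM x : 8 / 10 <= enorm x -> invmx (MM x) = MMinv x.
Proof.
move=> hx; have h := MM_out_mul x hx; have [u _] := mulmx1_unit h.
by rewrite -[LHS]mulmx1 -h mulKmx.
Qed.

(** The least eigenvalue of [B^-1] is [3 - sqrt 5], above 1/2. *)
Lemma MMinv_form_ge x w : x != 0 ->
  1 / 2 * enorm w ^+ 2 <= inner w (MMinv x *m w).
Proof.
rewrite -enorm_gt0 => x0; have s0 := exprn_gt0 2 x0.
have sn0 := lt0r_neq0 s0.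
rewrite sqr_enorm innerE !mulmx2E /MMinv !mxE /=.
rewrite -subr_ge0 -(pmulr_lge0 _ s0).
move: s0 sn0; rewrite sqr_enorm.
move: (x 0 0) (x 1 0) (w 0 0) (w 1 0) => u v a b s0 sn0.
set m := a * u + b * v; set n := b * u - a * v.
have q : 0 <= 3 / 2 * (m + 4 / 3 * n) ^+ 2 + 5 / 6 * n ^+ 2.
  by rewrite addr_ge0// mulr_ge0 ?sqr_ge0//; lra.
by apply: (eq_ind _ (fun z => 0 <= z) q); rewrite /m /n; field.
Qed.

(** The objective vanishes at [y] and is at least [c / 2 * |w - y|^2] at any [w], so [y] is the only
    minimizer that [xget] can return. *)
Lemma proj_id (S : set 'cV[R]_2) (Q : 'M[R]_2) y (c : R) : 0 < c ->
  (forall w, c * enorm w ^+ 2 <= inner w (Q *m w)) -> S y -> Defs.proj S Q y = y.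
Proof.
move=> c0 hQ Sy.
have o : proj_obj Q y y = 0.
  by rewrite /proj_obj subrr mulmx0 innerE !mxE !mul0r addr0 mulr0.
have ge w : c / 2 * enorm (w - y) ^+ 2 <= proj_obj Q y w.
  by rewrite /proj_obj; have := hQ (w - y); lra.
have yP : is_proj S Q y y.
  split=> // w _; rewrite o; apply: le_trans (ge w).
  by rewrite mulr_ge0 ?sqr_ge0//; lra.
have [_ /(_ y Sy)] : is_proj S Q y (Defs.proj S Q y).
  exact: (@xgetPex _ y [set z | is_proj S Q y z] (ex_intro _ y yP)).
rewrite o => h; apply/eqP; rewrite -subr_eq0; apply/eqP/enorm0_eq0.
apply/eqP; rewrite -sqrf_eq0 eq_le sqr_ge0 andbT.
have := ge (Defs.proj S Q y); set t := _ ^+ 2; nra.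
Qed.

Lemma r_alpha_sqr s : 8 / 10 <= s <= r_alpha R ->
  s ^+ 2 * (1 + (@alpha R / 2) ^+ 2) <= (11 / 10) ^+ 2.
Proof.
move=> /andP[s0]; rewrite /r_alpha.
have q0 : 0 < 1 + @alpha R ^+ 2 / 4 by rewrite /alpha; lra.
have -> : 1 + (@alpha R / 2) ^+ 2 = 1 + @alpha R ^+ 2 / 4 by field.
rewrite ler_pdivlMr ?sqrtr_gt0// -ler_sqr ?nnegrE ?mulr_ge0 ?sqrtr_ge0//; try lra.
by rewrite exprMn sqr_sqrtr// ltW.
Qed.

(** In the frame [(e_r, e_theta)], [F x] is [s (1, 2)] and [B] sends [(1, 2)] to [(0, 1/2)]: the
    step is purely tangential. *)
Lemma fieldE x : 8 / 10 <= enorm x <= r_alpha R ->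
  field x = - (@alpha R / 2) *: (J R *m x).
Proof.
move=> hx; have /andP[x1 _] := hx.
have s0 : enorm x ^+ 2 != 0 by rewrite expf_neq0// lt0r_neq0//; lra.
have E : x - @alpha R *: (MM x *m F x) = x - (@alpha R / 2) *: (J R *m x).
  rewrite MME /term phi0_out// /mono /F.
  move: s0; rewrite sqr_enorm => s0.
  by apply: cV2_eq; rewrite !(mulmx2E, entryE, mx2E) /=; field.
rewrite /field /lambda scale1r /T /T_map E invmx_MM// (proj_id _ _ _ (1 / 2)).
- by rewrite addrAC subrr sub0r scaleNr.
- lra.
- move=> w; apply: MMinv_form_ge; rewrite -enorm_gt0; lra.
- rewrite /Sball /= enorm_le_sqr; last lra.
  apply: le_trans (r_alpha_sqr _ hx); rewrite sqr_enorm.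
  rewrite /J !(entryE, mulmx2E, mx2E).
  by rewrite -subr_ge0; apply: (eq_ind _ (fun u => 0 <= u) (lexx 0)); ring.
Qed.

End Dynamics.

(** * Circles as orbits of a uniform rotation *)

Section Orbits.
Variable R : realType.
Implicit Types (x v : 'cV[R]_2) (s t : R).

Let w : R := @alpha R / 2.

Let w_gt0 : 0 < w. Proof. by rewrite /w /alpha; lra. Qed.

(** The motion is clockwise, with angular speed [alpha / 2], which explains the sign of the sine. *)
Definition rotation s t : 'cV[R]_2 :=
  (s * cos (w * t)) *: unit_vec R 0 + (- (s * sin (w * t))) *: unit_vec R 1.

Lemma rotation0E s t : rotation s t 0 0 = s * cos (w * t).
Proof. by rewrite !mxE /= mulr1 mulr0 addr0. Qed.

Lemma rotation1E s t : rotation s t 1 0 = - (s * sin (w * t)).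
Proof. by rewrite !mxE /= mulr1 mulr0 add0r. Qed.

Lemma enorm_rotation s t : 0 <= s -> enorm (rotation s t) = s.
Proof.
move=> s0; apply: enorm_eq_sqr => //; rewrite rotation0E rotation1E.
by rewrite sqrrN !exprMn -mulrDr cos2Dsin2 mulr1.
Qed.

Lemma is_derive_rotation s t :
  is_derive t (1 : R) (rotation s) (- w *: (J R *m rotation s t)).
Proof.
have dw : is_derive t (1 : R) (fun t : R => w * t) w.
  by apply: (is_derive_eq (is_deriveZ w (is_derive_id t (1 : R)))); rewrite /GRing.scale /= mulr1.
have dc : is_derive t (1 : R) (fun t : R => s * cos (w * t)) _ :=
  is_deriveZ s (is_derive_comp_real (is_derive_cos (w * t)) dw).
have ds : is_derive t (1 : R) (fun t : R => - (s * sin (w * t))) _ :=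
  is_deriveN (is_deriveZ s (is_derive_comp_real (is_derive_sin (w * t)) dw)).
have d : is_derive t (1 : R) (rotation s) _ :=
  is_deriveD (is_derive_scalel (unit_vec R 0) dc)
    (is_derive_scalel (unit_vec R 1) ds).
apply: (is_derive_eq d); rewrite /J /unit_vec.
by apply: cV2_eq; rewrite !(entryE, mulmx2E, mx2E) !mxE /= /GRing.scale /=; ring.
Qed.

Lemma range_rotation s : 0 < s -> range (rotation s) = circle s.
Proof.
move=> s0; apply/seteqP; split => [_ [t _ <-]|x xs].
  by rewrite /circle /= enorm_rotation// ltW.
have sn0 := lt0r_neq0 s0; have wn0 := lt0r_neq0 w_gt0.
have s2 := sqr_enorm R x; rewrite /circle /= in xs; rewrite xs in s2.
have c1 : -1 <= x 0 0 / s <= 1.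
  by rewrite -ler_norml normrM normfV (gtr0_norm s0) ler_pdivrMr// mul1r -xs coord_le_enorm.
have sn : sin (acos (x 0 0 / s)) = `|x 1 0| / s.
  rewrite sin_acos//; have -> : 1 - (x 0 0 / s) ^+ 2 = (x 1 0 / s) ^+ 2.
    have -> : 1 - (x 0 0 / s) ^+ 2 = (s ^+ 2 - x 0 0 ^+ 2) / s ^+ 2 by field.
    by rewrite (_ : s ^+ 2 - _ = x 1 0 ^+ 2) ?exprMn ?exprVn// s2 addrAC subrr add0r.
  by rewrite sqrtr_sqr normrM normfV (gtr0_norm s0).
have cs : cos (acos (x 0 0 / s)) = x 0 0 / s by rewrite acosK.
(* [acos] only yields angles with nonnegative sine. As the rotation is clockwise, such times cover
   the lower half-plane and their opposites the upper one. *)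
have [x1|x1] := leP (x 1 0) 0.
- exists (acos (x 0 0 / s) / w) => //.
  apply: cV2_eq; rewrite ?rotation0E ?rotation1E [w * _]mulrC divfK//.
    by rewrite cs mulrC divfK.
  by rewrite sn mulrC divfK// ler0_norm// opprK.
- exists (- acos (x 0 0 / s) / w) => //.
  apply: cV2_eq; rewrite ?rotation0E ?rotation1E [w * _]mulrC divfK//.
    by rewrite cosN cs mulrC divfK.
  by rewrite sinN sn mulrN opprK mulrC divfK// gtr0_norm.
Qed.

Lemma periodic_orbit_circle s : 8 / 10 <= s <= r_alpha R ->
  periodic_orbit (@Sball R) (@field R) (circle s).
Proof.
move=> hs; have /andP[s1 _] := hs; have s0 : 0 < s by lra.
have wn0 := lt0r_neq0 w_gt0.
exists (rotation s), (pi *+ 2 / w); split.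
- move=> t; split.
    rewrite /Sball /= enorm_rotation; last exact: ltW.
    have := r_alpha_sqr R s hs; have := sqr_ge0 (@alpha R / 2); nra.
  have e : enorm (rotation s t) = s by apply: enorm_rotation; exact: ltW.
  by rewrite fieldE ?e//; exact: is_derive_rotation.
- by rewrite divr_gt0// mulrn_wgt0// pi_gt0.
- move=> t; rewrite /rotation mulrDr [w * (_ / w)]mulrC divfK//.
  by rewrite cosD2pi sinD2pi.
(* After half a period the first coordinate has gone from [s] to [- s]. *)
- exists (pi / w) => /(congr1 (fun v : 'cV[R]_2 => v 0 0)).
  by rewrite !rotation0E mulr0 cos0 mulrC [w * _]mulrC divfK// cospi; lra.
- exact: range_rotation.
Qed.

End Orbits.

(** * Obstruction to a potential for the inverse metric *)

Section NotHessian.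
Variable R : realType.
Implicit Types (x v : 'cV[R]_2).

(** The rational 12/10 lies just below the square of [r_alpha], about 1.209, so later checks involve
    no square root. *)
Lemma annulus_interior x : 64 / 100 < enorm x ^+ 2 -> enorm x ^+ 2 < 12 / 10 ->
  (@annulus R)° x.
Proof.
move=> h1 h2.
have x1 : 8 / 10 < enorm x.
  by rewrite -ltr_sqr ?nnegrE ?enorm_ge0//; lra.
have x2 : enorm x < r_alpha R.
  have q0 : 0 < 1 + @alpha R ^+ 2 / 4 by rewrite /alpha; lra.
  rewrite /r_alpha ltr_pdivlMr ?sqrtr_gt0//.
  rewrite -ltr_sqr ?nnegrE; first last; [lra|by rewrite mulr_ge0 ?sqrtr_ge0 ?enorm_ge0|].
  rewrite exprMn (sqr_sqrtr (ltW q0)).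
  by rewrite /alpha; lra.
have n1 : \forall y \near x, 8 / 10 < enorm y.
  exact: (continuous_enorm R x _ (lt_nbhsr x1)).
have n2 : \forall y \near x, enorm y < r_alpha R.
  exact: (continuous_enorm R x _ (lt_nbhsl x2)).
apply: filterS2 n1 n2 => y y1 y2.
by rewrite /annulus /=; apply/andP; split; exact: ltW.
Qed.

Lemma not_hessian_annulus :
  ~ (exists phi : 'cV[R]_2 -> R,
       is_hessian_on (@annulus R) phi (fun x => invmx (MM x))).
Proof.
move=> [phi H].
pose G := 'D_(unit_vec R 0) phi.
have dG x v : 64 / 100 < enorm x ^+ 2 -> enorm x ^+ 2 < 12 / 10 ->
    is_derive x v G (v 0 0 * MMinv R x 0 0 + v 1 0 * MMinv R x 1 0).
  move=> h1 h2; have [[_ /(_ 0) dG] hE] := H x (annulus_interior x h1 h2).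
  constructor; first exact: diff_derivable.
  (* [G] is the first partial derivative of [phi], so its own partials form the first column of the
     Hessian. *)
  have Gi i : 'd G x (unit_vec R i) = MMinv R x i 0.
    rewrite -deriveE// -invmx_MM; last first.
      by rewrite -ler_sqr ?nnegrE ?enorm_ge0//; lra.
    by rewrite -hE mxE.
  rewrite deriveE//.
  have {1}-> : v = v 0 0 *: unit_vec R 0 + v 1 0 *: unit_vec R 1.
    by apply: cV2_eq; rewrite !mxE /= ?mulr1 ?mulr0 ?addr0 ?add0r.
  by rewrite linearD !linearZ /= !Gi.
pose e0 : 'cV[R]_2 := unit_vec R 0; pose e1 : 'cV[R]_2 := unit_vec R 1.
(* For [r] between 9/10 and 1 and [|tau| <= 1/10], the squared norm [r^2 (1 + tau^2)] stays between
   0.81 and 1.01, inside the admissible range. *)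
pose c : R := 9 / 10.
(* [MMinv] is homogeneous of degree 0, so [MMinv (r *: u) *m u] does not depend
   on [r]; its first coordinate is [2 * (1 - tau)] for [u = (1, tau)]. *)
have radial (tau : R) : `|tau| <= 1 / 10 ->
    G (tau *: e1 + e0) - G (tau *: (c *: e1) + c *: e0) = (1 - tau) / 5.
  rewrite ler_norml => /andP[t1 t2].
  set u := tau *: e1 + e0.
  have -> : tau *: (c *: e1) + c *: e0 = c *: u + 0.
    by rewrite addr0 scalerDr !scalerA mulrC.
  rewrite (_ : G u = G (1 *: u + 0)); last by rewrite scale1r addr0.
  have u0 : u 0 0 = 1 by rewrite !mxE /= mulr0 add0r.
  have u1 : u 1 0 = tau by rewrite !mxE /= mulr1 addr0.
  clearbody u.
  have d (r : R) : c <= r <= 1 ->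
      is_derive r 1 (fun h : R => G (h *: u + 0)) (2 * (1 - tau)).
    move=> /andP[r1 r2]; apply/is_derive_line.
    have ru : enorm (r *: u + 0) ^+ 2 = r ^+ 2 * (1 + tau ^+ 2).
      by rewrite sqr_enorm addr0 !(entryE) u0 u1; ring.
    have t3 : tau ^+ 2 <= 1 / 100 by nra.
    have r3 : 81 / 100 <= r ^+ 2 by rewrite /c in r1; nra.
    have r4 : r ^+ 2 <= 1 by rewrite /c in r1; nra.
    have t4 := sqr_ge0 tau.
    have dd := dG (r *: u + 0) u ltac:(rewrite ru; nra) ltac:(rewrite ru; nra).
    apply: (is_derive_eq dd).
    rewrite /MMinv ru addr0 !(entryE, mx2E) u0 u1 /=; field.
    by apply/andP; split; apply: lt0r_neq0; rewrite /c in r1; nra.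
  have cont : {within `[c, 1], continuous (fun h : R => G (h *: u + 0))}.
    apply: derivable_within_continuous => r; rewrite in_itv /= => hr.
    by have [] := d r hr.
  have c1 : c < 1 by rewrite /c; lra.
  (* The slope along the ray is constant, so the increment is exactly [2 (1 - tau) (1 - c)]. *)
  have [|r _ ->] := MVT c1 _ cont (df := fun=> 2 * (1 - tau)).
    by move=> r; rewrite in_itv /= => /andP[/ltW h1 /ltW h2]; apply: d; rewrite h1.
  by rewrite /c; field.
have e00 : e0 0 0 = 1 by rewrite mxE.
have e01 : e0 1 0 = 0 by rewrite mxE.
have e10 : e1 0 0 = 0 by rewrite mxE.
have e11 : e1 1 0 = 1 by rewrite mxE.
have ne0 : enorm e0 ^+ 2 = 1 by rewrite sqr_enorm e00 e01; ring.
have nce0 : enorm (c *: e0) ^+ 2 = 81 / 100.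
  by rewrite sqr_enorm !entryE e00 e01 /c; field.
have d1 : is_derive (0 : R) (1 : R) (fun t : R => G (t *: e1 + e0)) 2.
  apply/is_derive_line; rewrite scale0r add0r.
  apply: (is_derive_eq (dG e0 e1 _ _)); rewrite ?ne0; try lra.
  by rewrite /MMinv ne0 !(entryE, mx2E) e00 e01 e10 e11 /=; field.
have d2 : is_derive (0 : R) (1 : R) (fun t : R => G (t *: (c *: e1) + c *: e0)) (9 / 5).
  apply/is_derive_line; rewrite scale0r add0r.
  apply: (is_derive_eq (dG (c *: e0) (c *: e1) _ _)); rewrite ?nce0; try lra.
  by rewrite /MMinv nce0 !(entryE, mx2E) e00 e01 e10 e11 /= /c; field.
(* The chain rule gives the derivative [2 - 9/5 = 1/5], while the radial formula valid near 0 gives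
   [-1/5]. *)
have [_ D] := is_deriveB d1 d2.
have d3 : is_derive (0 : R) (1 : R) (fun t : R => (1 - t) / 5) (- (1 / 5)).
  apply: (is_derive_eq (is_deriveM (is_deriveB (is_derive_cst (1 : R) 0 (1 : R))
    (is_derive_id 0 (1 : R))) (is_derive_cst (5^-1 : R) 0 (1 : R)))).
  by rewrite /GRing.scale /=; field.
have nr : \forall t \near (0 : R), (1 - t) / 5
    = ((fun t : R => G (t *: e1 + e0)) - (fun t : R => G (t *: (c *: e1) + c *: e0))) t.
  have n0 : \forall t \near (0 : R), `|t| <= 1 / 10 by apply: nbhs0_le; lra.
  by apply: filterS n0 => t ht; rewrite -radial.
have [_] := near_eq_is_derive nr d3; rewrite D; lra.
Qed.

End NotHessian.

Theorem mainTheorem5 (R : realType) :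
  (* the operator F and the variational inequality *)
  (strongly_monotone 1 (@Sball R) (@F R) /\
   elipschitz (Num.sqrt 5) (@F R)) /\
  (VI_solution (@F R) (@Sball R) 0 /\
   forall x : 'cV[R]_2, VI_solution (@F R) (@Sball R) x -> x = 0) /\
  (* the metric *)
  posdef (B R) /\
  C2 (@MM R) /\
  uniformly_posdef (@MM R) /\
  matrix_lipschitz (@MM R) /\
  (differentiable (@MM R) 0 /\
   forall v : 'cV[R]_2, 'd (@MM R) 0 v = 0) /\
  (* periodic orbits *)
  (forall s : R, 8 / 10 <= s <= r_alpha R ->
     periodic_orbit (@Sball R) (@field R) (circle s)) /\
  (* the inverse metric is not a Hessian *)
  ~ (exists phi : 'cV[R]_2 -> R,
       is_hessian_on (@annulus R) phi (fun x => invmx (MM x))).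
Proof.
split; first by split; [exact: strongly_monotone_F | exact: elipschitz_F].
split; first by split; [exact: VI_solution_F0 | exact: VI_solution_F_eq0].
split; first exact: posdef_B.
split; first exact: C2_MM.
split; first exact: uniformly_posdef_MM.
split; first exact: matrix_lipschitz_MM.
split.
  by have [d dE] := is_diff_MM0 R; split=> // v; rewrite dE.
split; first exact: periodic_orbit_circle.
exact: not_hessian_annulus.
Qed.
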